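(* Let $q\in\mathbb{C}$ with $0<|q|<1$, let $t_1,t_2,t_3$ be mutually distinct non-zero complex numbers, and let $h_1,h_2,h_3,l_1,l_2,l_3,\alpha$ be parameters. Set $\lambda=(h_1+h_2+h_3-l_1-l_2-l_3+1)/2$. Consider the equation $$(x-q^{h_1+1/2}t_1)(x-q^{h_2+1/2}t_2)(x-q^{h_3+1/2}t_3)g(x/q)$$ $$+q^{2\alpha+1}(x-q^{l_1-1/2}t_1)(x-q^{l_2-1/2}t_2)(x-q^{l_3-1/2}t_3)g(qx)$$ $$+q^{\alpha}\Big[-(q+1)x^3+q^{1/2}\{(q^{h_1}+q^{l_1})t_1+(q^{h_2}+q^{l_2})t_2+(q^{h_3}+q^{l_3})t_3\}x^2$$ $$-q^{(h_1+h_2+h_3+l_1+l_2+l_3+1)/2}\{(q^{-h_1}+q^{-l_1})t_2t_3+(q^{-h_2}+q^{-l_2})t_1t_3+(q^{-h_3}+q^{-l_3})t_1t_2\}x$$ $$+q^{(h_1+h_2+h_3+l_1+l_2+l_3)/2}(q+1)t_1t_2t_3\Big]g(x)-q^{\alpha+l_1+l_2+l_3-1/2}t_1t_2t_3(1-q^\lambda)x^{1-\alpha}=0.\qquad(\ast)$$ (i) Let $(i,i',i'')$ be a permutation of $(1,2,3)$. The function $$g_i^{\langle1\rangle}(x)=x^{-\alpha}q^{l_i-1/2}t_i\frac{(q^{\lambda+l_i+1/2}t_i/x,\ q^{l_i-l_{i'}+1}t_i/t_{i'},\ q^{l_i-l_{i''}+1}t_i/t_{i''},\ q;q)_\infty}{(q^{l_i+1/2}t_i/x,\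 q^{\lambda+l_i-h_i},\ q^{\lambda+l_i-h_{i'}}t_i/t_{i'},\ q^{\lambda+l_i-h_{i''}}t_i/t_{i''};q)_\infty}$$ $$\times{}_4\phi_3\left(\begin{array}{c}q^{l_i+1/2}t_i/x,\ q^{\lambda+l_i-h_i},\ q^{\lambda+l_i-h_{i'}}t_i/t_{i'},\ q^{\lambda+l_i-h_{i''}}t_i/t_{i''}\\ q^{\lambda+l_i+1/2}t_i/x,\ q^{l_i-l_{i'}+1}t_i/t_{i'},\ q^{l_i-l_{i''}+1}t_i/t_{i''}\end{array};q,q\right)$$ satisfies $(\ast)$. (ii) The function $$g_0^{\langle1\rangle}(x)=x^{1-\alpha}q^{-\lambda}\frac{(xq^{-\lambda-l_1+3/2}/t_1,\ xq^{-\lambda-l_2+3/2}/t_2,\ xq^{-\lambda-l_3+3/2}/t_3,\ q;q)_\infty}{(xq^{-h_1+1/2}/t_1,\ xq^{-h_2+1/2}/t_2,\ xq^{-h_3+1/2}/t_3,\ q^{-\lambda+1};q)_\infty}$$ $$\times{}_4\phi_3\left(\begin{array}{c}xq^{-h_1+1/2}/t_1,\ xq^{-h_2+1/2}/t_2,\ xq^{-h_3+1/2}/t_3,\ q^{-\lambda+1}\\ xq^{-\lambda-l_1+3/2}/t_1,\ xq^{-\lambda-l_2+3/2}/t_2,\ xq^{-\lambda-l_3+3/2}/t_3\end{array};q,q\right)$$ also satisfies $(\ast)$.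
   Context: Notation: $(a;q)_\infty=\prod_{j\ge0}(1-q^ja)$, $(a_1,\dots,a_r;q)_\infty=\prod_i(a_i;q)_\infty$, $(a;q)_0=1$, $(a;q)_n=\prod_{j=0}^{n-1}(1-aq^j)$, and $${}_4\phi_3\left(\begin{array}{c}a_1,a_2,a_3,a_4\\ c_1,c_2,c_3\end{array};q,z\right)=\sum_{n\ge0}\frac{(a_1;q)_n(a_2;q)_n(a_3;q)_n(a_4;q)_n}{(q;q)_n(c_1;q)_n(c_2;q)_n(c_3;q)_n}z^n.$$ Powers: a branch of $\log q$ is fixed, $q^a=e^{a\log q}$, and $x^a$ is taken with a branch chosen along each orbit $\{q^nx\}_{n\in\mathbb{Z}}$ so that $(q^nx)^a=q^{na}x^a$. The statement is understood for parameter values and $x\ne0$ for which no denominator vanishes. *)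

(* Defs.v *)
From Stdlib Require Export Reals List.
From Coquelicot Require Export Coquelicot.
Export ListNotations.

Open Scope R_scope.
Open Scope C_scope.

Definition Cexp (z : C) : C := (exp (Re z) * cos (Im z), exp (Re z) * sin (Im z))%R.

(* Limits and sums of complex sequences, taken componentwise; as for [Lim_seq]
   and [Series], the value is unspecified when there is no convergence. *)
Definition CLim_seq (u : nat -> C) : C :=
  (real (Lim_seq (fun n => Re (u n))), real (Lim_seq (fun n => Im (u n)))).

Definition CSeries (u : nat -> C) : C :=
  (Series (fun n => Re (u n)), Series (fun n => Im (u n))).

Definition Cprod (s : list C) : C := fold_right Cmult 1 s.

(* (a;q)_n *)
Fixpoint qpoch (q a : C) (n : nat) : C :=
  match n with
  | O => 1
  | S m => qpoch q a m * (1 - a * q ^ m)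
  end.

(* (a;q)_oo *)
Definition qpoch_inf (q a : C) : C := CLim_seq (qpoch q a).

(* (a_1,...,a_r;q)_oo *)
Definition qpochs_inf (q : C) (s : list C) : C := Cprod (map (qpoch_inf q) s).

(* (q;q)_n (c_1;q)_n ... (c_s;q)_n *)
Definition phi_den (q : C) (cs : list C) (n : nat) : C :=
  qpoch q q n * Cprod (map (fun c => qpoch q c n) cs).

(* {}_{s+1}phi_s, for [length aa = s + 1] and [length cs = s]; below s = 3. *)
Definition phi (aa cs : list C) (q z : C) : C :=
  CSeries (fun n => Cprod (map (fun a => qpoch q a n) aa) / phi_den q cs n * z ^ n).

(* q^a, for the branch [logq] of log q *)
Definition qpow (logq a : C) : C := Cexp (a * logq).

(* x^a, for the choice [logx] of a logarithm of each non-zero number *)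
Definition xpow (logx : C -> C) (x a : C) : C := Cexp (a * logx x).

Inductive idx : Set := i1 | i2 | i3.

Definition lam (h l : idx -> C) : C :=
  (h i1 + h i2 + h i3 - l i1 - l i2 - l i3 + 1) / 2.

(* The equation ( * ) at the point x. *)
Definition satisfies (q logq : C) (logx : C -> C) (h l t : idx -> C) (alpha : C)
    (g : C -> C) (x : C) : Prop :=
  let Q := qpow logq in
  (x - Q (h i1 + 1/2) * t i1) * (x - Q (h i2 + 1/2) * t i2)
    * (x - Q (h i3 + 1/2) * t i3) * g (x / q)
  + Q (2 * alpha + 1)
    * ((x - Q (l i1 - 1/2) * t i1) * (x - Q (l i2 - 1/2) * t i2)
       * (x - Q (l i3 - 1/2) * t i3)) * g (q * x)
  + Q alpha
    * (- (q + 1) * x ^ 3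
       + Q (1/2) * ((Q (h i1) + Q (l i1)) * t i1 + (Q (h i2) + Q (l i2)) * t i2
                    + (Q (h i3) + Q (l i3)) * t i3) * x ^ 2
       - Q ((h i1 + h i2 + h i3 + l i1 + l i2 + l i3 + 1) / 2)
         * ((Q (- h i1) + Q (- l i1)) * t i2 * t i3
            + (Q (- h i2) + Q (- l i2)) * t i1 * t i3
            + (Q (- h i3) + Q (- l i3)) * t i1 * t i2) * x
       + Q ((h i1 + h i2 + h i3 + l i1 + l i2 + l i3) / 2)
         * (q + 1) * t i1 * t i2 * t i3) * g x
  - Q (alpha + l i1 + l i2 + l i3 - 1/2) * t i1 * t i2 * t i3
    * (1 - Q (lam h l)) * xpow logx x (1 - alpha)
  = 0.

(* Upper and lower parameters of the 4phi3 in g_i^<1>, where (i, j, k) is the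
   permutation (i, i', i'').  The upper ones are also the entries of the infinite
   product in the denominator of the prefactor; the lower ones, together with q,
   are those of its numerator.  The same holds for g_0^<1>. *)
Definition upper_i (logq : C) (h l t : idx -> C) (i j k : idx) (x : C) : list C :=
  let Q := qpow logq in
  [ Q (l i + 1/2) * t i / x;
    Q (lam h l + l i - h i);
    Q (lam h l + l i - h j) * t i / t j;
    Q (lam h l + l i - h k) * t i / t k ].

Definition lower_i (logq : C) (h l t : idx -> C) (i j k : idx) (x : C) : list C :=
  let Q := qpow logq in
  [ Q (lam h l + l i + 1/2) * t i / x;
    Q (l i - l j + 1) * t i / t j;
    Q (l i - l k + 1) * t i / t k ].

Definition g_i (q logq : C) (logx : C -> C) (h l t : idx -> C) (alpha : C)
    (i j k : idx) (x : C) : C :=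
  let aa := upper_i logq h l t i j k x in
  let cs := lower_i logq h l t i j k x in
  xpow logx x (- alpha) * qpow logq (l i - 1/2) * t i
  * (qpochs_inf q (cs ++ [q]) / qpochs_inf q aa)
  * phi aa cs q q.

Definition upper_0 (logq : C) (h l t : idx -> C) (x : C) : list C :=
  let Q := qpow logq in
  [ x * Q (- h i1 + 1/2) / t i1;
    x * Q (- h i2 + 1/2) / t i2;
    x * Q (- h i3 + 1/2) / t i3;
    Q (- lam h l + 1) ].

Definition lower_0 (logq : C) (h l t : idx -> C) (x : C) : list C :=
  let Q := qpow logq in
  [ x * Q (- lam h l - l i1 + 3/2) / t i1;
    x * Q (- lam h l - l i2 + 3/2) / t i2;
    x * Q (- lam h l - l i3 + 3/2) / t i3 ].

Definition g_0 (q logq : C) (logx : C -> C) (h l t : idx -> C) (alpha : C) (x : C) : C :=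
  let aa := upper_0 logq h l t x in
  let cs := lower_0 logq h l t x in
  xpow logx x (1 - alpha) * qpow logq (- lam h l)
  * (qpochs_inf q (cs ++ [q]) / qpochs_inf q aa)
  * phi aa cs q q.

(* No denominator vanishes in the prefactor or in any term of the series. *)
Definition no_zero_den (q : C) (aa cs : list C) : Prop :=
  qpochs_inf q aa <> 0 /\ forall n : nat, phi_den q cs n <> 0.

(* Main.v *)
Require Import Defs.
From Stdlib Require Import Lra.

(** Both solutions are values of one Jackson integral. Put [L = q^lambda],
    [b_i = q^(h_i+1/2) t_i] and [d_i = q^(l_i-1/2) t_i]. Absorbing the infinite products
    of the prefactor into the terms of the series turns [g(x)] into [x^(-alpha)] times
    the sum of [s K(x, s)] over [s = s_0 q^n], [n >= 0], where
    [K(x, s) = (qLs/x; q)_oo / (qs/x; q)_oo * prod_i (qs/d_i; q)_oo / (qLs/b_i; q)_oo]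
    ([kernel]), with [s_0 = d_i] for the solutions of (i) and [s_0 = x/L] for that of
    (ii). In both cases a factor of [K] vanishes at [s = s_0/q], so the sum may be
    thought of as running over the whole lattice [s_0 q^Z].

    The powers [x^(-alpha)] and [x^(1-alpha)] drop out, and the equation becomes a
    relation between the sums at [x/q], [x] and [qx]
    ([satisfies_of_jackson_equation]). Applied to the summand [s K(x, s)], the
    left-hand side is an exact difference
    [q d_1 d_2 d_3 (1-L) x (T(qs) - T(s))] with
    [T(s) = (qLs/x; q)_oo / (s/x; q)_oo * prod_i (s/d_i; q)_oo / (qLs/b_i; q)_oo]
    ([antidifference], [summand_telescopes]); this reduces to a polynomial identity that
    uses only the balancing condition [q^2 L^2 d_1 d_2 d_3 = b_1 b_2 b_3], which is the
    definition of [lambda] ([root_balance]). Summation telescopes. At the far end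
    [T] tends to 1 and produces the inhomogeneous term in [x^(1-alpha)]
    ([jackson_equation]). At the near end [T(d_i) = 0], which settles (i)
    ([jackson_equation_fixed]). In (ii) the lattice moves with [x], so the three sums
    have different first terms; the excess terms are computed separately
    ([jackson_equation_moving]).

    The analytic input is small: [(a; q)_oo] converges, satisfies
    [(a; q)_oo = (a; q)_n (a q^n; q)_oo], and [(a q^n; q)_oo] tends to 1. Everything
    follows from the bound [|(a; q)_n - 1| <= exp (|a| / (1-|q|)) - 1]. *)

(** * Limits and series of complex sequences *)

Definition is_Clim (u : nat -> C) (l : C) : Prop :=
  is_lim_seq (fun n => Re (u n)) (Re l) /\ is_lim_seq (fun n => Im (u n)) (Im l).

Definition is_Cseries (u : nat -> C) (l : C) : Prop :=
  is_series (fun n => Re (u n)) (Re l) /\ is_series (fun n => Im (u n)) (Im l).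

Lemma is_Clim_unique u l : is_Clim u l -> CLim_seq u = l.
Proof.
  intros [H1 H2]; unfold CLim_seq.
  rewrite (is_lim_seq_unique _ _ H1), (is_lim_seq_unique _ _ H2).
  destruct l; reflexivity.
Qed.

Lemma is_Cseries_unique u l : is_Cseries u l -> CSeries u = l.
Proof.
  intros [H1 H2]; unfold CSeries.
  rewrite (is_series_unique _ _ H1), (is_series_unique _ _ H2).
  destruct l; reflexivity.
Qed.

Lemma is_Clim_ext u v l : (forall n, u n = v n) -> is_Clim u l -> is_Clim v l.
Proof.
  intros E [H1 H2]; split;
    [ eapply is_lim_seq_ext; [|exact H1] | eapply is_lim_seq_ext; [|exact H2] ];
    intros n; simpl; now rewrite E.
Qed.

Lemma is_Cseries_ext u v l : (forall n, u n = v n) -> is_Cseries u l -> is_Cseries v l.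
Proof.
  intros E [H1 H2]; split;
    [ eapply is_series_ext; [|exact H1] | eapply is_series_ext; [|exact H2] ];
    intros n; simpl; now rewrite E.
Qed.

Lemma is_Clim_const c : is_Clim (fun _ => c) c.
Proof. split; apply is_lim_seq_const. Qed.

Lemma is_Clim_mult u v l m :
  is_Clim u l -> is_Clim v m -> is_Clim (fun n => u n * v n) (l * m).
Proof.
  intros [H1 H2] [H3 H4]; split; simpl.
  - apply (is_lim_seq_minus' _ _ (Re l * Re m) (Im l * Im m));
      now apply is_lim_seq_mult'.
  - apply (is_lim_seq_plus' _ _ (Re l * Im m) (Im l * Re m));
      now apply is_lim_seq_mult'.
Qed.

Lemma Cnorm2_neq0 (z : C) : z <> 0 -> (Re z ^ 2 + Im z ^ 2 <> 0)%R.
Proof.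
  intros Hz E; apply Hz; destruct z as [x y]; simpl in E.
  assert (x = 0%R /\ y = 0%R) as [-> ->] by (split; nra); reflexivity.
Qed.

Lemma is_Clim_inv u (l : C) : l <> 0 -> is_Clim u l -> is_Clim (fun n => / u n) (/ l).
Proof.
  intros Hl [H1 H2].
  assert (N : is_lim_seq (fun n => Re (u n) ^ 2 + Im (u n) ^ 2)%R
                (Re l ^ 2 + Im l ^ 2)%R).
  { simpl. apply is_lim_seq_plus'; repeat apply is_lim_seq_mult';
      auto using is_lim_seq_const. }
  split; simpl.
  - exact (is_lim_seq_div' _ _ _ _ H1 N (Cnorm2_neq0 _ Hl)).
  - apply (is_lim_seq_div' _ _ (- Im l) _); [|exact N|exact (Cnorm2_neq0 _ Hl)].
    now apply -> is_lim_seq_opp in H2.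
Qed.

Lemma is_Clim_div u v (l m : C) :
  m <> 0 -> is_Clim u l -> is_Clim v m -> is_Clim (fun n => u n / v n) (l / m).
Proof. intros Hm Hu Hv; apply is_Clim_mult; [|apply is_Clim_inv]; auto. Qed.

Lemma is_Cseries_plus u v l m :
  is_Cseries u l -> is_Cseries v m -> is_Cseries (fun n => u n + v n) (l + m).
Proof.
  intros [H1 H2] [H3 H4]; split.
  - exact (is_series_plus _ _ _ _ H1 H3).
  - exact (is_series_plus _ _ _ _ H2 H4).
Qed.

Lemma is_Cseries_scal c u l : is_Cseries u l -> is_Cseries (fun n => c * u n) (c * l).
Proof.
  intros [H1 H2]; split; simpl.
  - exact (is_series_minus _ _ _ _ (is_series_scal (Re c) _ _ H1)
             (is_series_scal (Im c) _ _ H2)).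
  - exact (is_series_plus _ _ _ _ (is_series_scal (Re c) _ _ H2)
             (is_series_scal (Im c) _ _ H1)).
Qed.

Lemma is_Cseries_tail u l :
  is_Cseries u l -> is_Cseries (fun n => u (S n)) (l - u O).
Proof.
  intros [H1 H2]; split.
  - apply (is_series_incr_1 (fun n => Re (u n))).
    replace (plus _ _) with (Re l); [exact H1|].
    change (Re l = Re l - Re (u O) + Re (u O))%R; ring.
  - apply (is_series_incr_1 (fun n => Im (u n))).
    replace (plus _ _) with (Im l); [exact H2|].
    change (Im l = Im l - Im (u O) + Im (u O))%R; ring.
Qed.

Lemma is_series_telescope (f : nat -> R) (L : R) :
  is_lim_seq f L -> is_series (fun n => f (S n) - f n)%R (L - f O)%R.
Proof.
  intros H.
  change (is_lim_seq (sum_n (fun n => f (S n) - f n)%R) (L - f O)%R).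
  apply is_lim_seq_ext with (fun n => f (S n) - f O)%R.
  - induction n as [|n IH].
    + now rewrite sum_O.
    + rewrite sum_Sn, <- IH; unfold plus; simpl; ring.
  - apply is_lim_seq_minus'; [|apply is_lim_seq_const].
    now apply -> is_lim_seq_incr_1 in H.
Qed.

Lemma is_Cseries_telescope (f : nat -> C) (L : C) :
  is_Clim f L -> is_Cseries (fun n => f (S n) - f n) (L - f O).
Proof.
  intros [H1 H2]; split.
  - exact (is_series_telescope _ _ H1).
  - exact (is_series_telescope _ _ H2).
Qed.

Lemma is_lim_seq_bounded (u : nat -> R) (l : R) :
  is_lim_seq u l -> exists M, forall n, (Rabs (u n) <= M)%R.
Proof.
  intros H.
  destruct (filterlim_bounded (V := R_NormedModule) u) as [M HM]; [now exists l|].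
  now exists M.
Qed.

Lemma Re_le_Cmod (z : C) : (Rabs (Re z) <= Cmod z)%R.
Proof. eapply Rle_trans; [apply Rmax_l|apply Rmax_Cmod]. Qed.

Lemma Im_le_Cmod (z : C) : (Rabs (Im z) <= Cmod z)%R.
Proof. eapply Rle_trans; [apply Rmax_r|apply Rmax_Cmod]. Qed.

Lemma Cmod_le_Re_Im (z : C) : (Cmod z <= Rabs (Re z) + Rabs (Im z))%R.
Proof.
  apply Rsqr_incr_0_var.
  - unfold Cmod; rewrite Rsqr_sqrt by nra.
    destruct z as [x y]; simpl.
    rewrite <- (Rabs_pos_eq (x * (x * 1))), <- (Rabs_pos_eq (y * (y * 1))) by nra.
    rewrite !Rabs_mult, Rabs_R1; unfold Rsqr.
    pose proof (Rabs_pos x); pose proof (Rabs_pos y); nra.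
  - pose proof (Rabs_pos (Re z)); pose proof (Rabs_pos (Im z)); lra.
Qed.

Lemma ex_Cseries_geom (r M : R) (u : nat -> C) :
  (0 <= r < 1)%R -> (forall n, (Cmod (u n) <= M * r ^ n)%R) ->
  exists l, is_Cseries u l.
Proof.
  intros Hr Hu.
  assert (HG : ex_series (fun n => M * r ^ n)%R).
  { exists (M * (1 / (1 - r)))%R. unfold Rdiv; rewrite Rmult_1_l.
    apply (is_series_scal M (fun n => r ^ n)%R).
    apply is_series_geom; rewrite Rabs_pos_eq; lra. }
  assert (H1 : ex_series (fun n => Re (u n))).
  { apply (ex_series_le (V := R_CompleteNormedModule)) with (2 := HG); intros n.
    eapply Rle_trans; [apply Re_le_Cmod|apply Hu]. }
  assert (H2 : ex_series (fun n => Im (u n))).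
  { apply (ex_series_le (V := R_CompleteNormedModule)) with (2 := HG); intros n.
    eapply Rle_trans; [apply Im_le_Cmod|apply Hu]. }
  destruct H1 as [l1 H1], H2 as [l2 H2].
  now exists (l1, l2).
Qed.

Lemma ex_Cseries_mult_geom (q : C) (w : nat -> C) (l : C) :
  (Cmod q < 1)%R -> is_Clim w l -> exists S, is_Cseries (fun n => w n * q ^ n) S.
Proof.
  intros Hq [H1 H2].
  destruct (is_lim_seq_bounded _ _ H1) as [M1 B1].
  destruct (is_lim_seq_bounded _ _ H2) as [M2 B2].
  apply (ex_Cseries_geom (Cmod q) (M1 + M2)).
  - split; [apply Cmod_ge_0|exact Hq].
  - intros n; rewrite Cmod_mult, Cmod_pow.
    apply Rmult_le_compat_r; [apply pow_le, Cmod_ge_0|].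
    eapply Rle_trans; [apply Cmod_le_Re_Im|]. specialize (B1 n); specialize (B2 n).
    lra.
Qed.

(** * Infinite q-shifted factorials *)

(** The exponent is [|a|] times the partial sum [1 + |q| + ... + |q|^(n-1)]: expanding
    the product gives at most what [prod_j (1 + |a| |q|^j)] would, and
    [1 + u <= exp u]. The bound keeps track of the distance to 1, not just of the size,
    because it has to tend to 0 with [a]. *)
Lemma qpoch_sub1_le (q a : C) (n : nat) :
  (Cmod q < 1)%R ->
  (Cmod (qpoch q a n - 1)
   <= exp (Cmod a * (1 - Cmod q ^ n) / (1 - Cmod q)) - 1)%R.
Proof.
  intros Hq; induction n as [|n IH].
  - simpl. replace (1 - 1) with (RtoC 0) by ring. rewrite Cmod_0.
    replace (_ / _)%R with 0%R by (field; lra). rewrite exp_0; lra.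
  - set (S0 := (Cmod a * (1 - Cmod q ^ n) / (1 - Cmod q))%R) in *.
    set (e := (Cmod a * Cmod q ^ n)%R).
    replace (Cmod a * (1 - Cmod q ^ S n) / (1 - Cmod q))%R with (S0 + e)%R
      by (unfold S0, e; simpl; field; lra).
    simpl qpoch.
    replace (qpoch q a n * (1 - a * q ^ n) - 1)
      with ((qpoch q a n - 1) - (1 + (qpoch q a n - 1)) * (a * q ^ n)) by ring.
    set (p := qpoch q a n - 1) in *.
    assert (He : Cmod (a * q ^ n) = e) by (unfold e; now rewrite Cmod_mult, Cmod_pow).
    assert (He0 : (0 <= e)%R) by (rewrite <- He; apply Cmod_ge_0).
    eapply Rle_trans; [apply Cmod_triangle|].
    rewrite Cmod_opp, Cmod_mult, He.
    assert (H1 : (Cmod (1 + p) <= 1 + Cmod p)%R).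
    { eapply Rle_trans; [apply Cmod_triangle|]. rewrite Cmod_1; lra. }
    rewrite exp_plus. pose proof (exp_ineq1_le e). pose proof (exp_pos S0).
    pose proof (Cmod_ge_0 p). nra.
Qed.

Definition qbound (q a : C) : R := exp (Cmod a / (1 - Cmod q)).

Lemma qpoch_sub1_le_qbound (q a : C) (n : nat) :
  (Cmod q < 1)%R -> (Cmod (qpoch q a n - 1) <= qbound q a - 1)%R.
Proof.
  intros Hq; eapply Rle_trans; [now apply qpoch_sub1_le|].
  apply Rplus_le_compat_r.
  unfold qbound.
  assert (H : (Cmod a * (1 - Cmod q ^ n) / (1 - Cmod q) <= Cmod a / (1 - Cmod q))%R).
  { apply Rmult_le_compat_r; [left; apply Rinv_0_lt_compat; lra|].
    pose proof (pow_le _ n (Cmod_ge_0 q)); pose proof (Cmod_ge_0 a); nra. }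
  destruct H as [H|H]; [left; now apply exp_increasing|right; now rewrite H].
Qed.

(** The increments [- (a; q)_n a q^n] are dominated by a geometric series. *)
Lemma is_Clim_qpoch (q a : C) :
  (Cmod q < 1)%R -> is_Clim (qpoch q a) (qpoch_inf q a).
Proof.
  intros Hq.
  destruct (ex_Cseries_geom (Cmod q) (qbound q a * Cmod a)
              (fun n => qpoch q a (S n) - qpoch q a n)) as [l Hl].
  - split; [apply Cmod_ge_0|exact Hq].
  - intros n; simpl.
    replace (_ - _) with (- (qpoch q a n * (a * q ^ n))) by ring.
    rewrite Cmod_opp, !Cmod_mult, Cmod_pow.
    rewrite Rmult_assoc; apply Rmult_le_compat_r.
    + apply Rmult_le_pos; [apply Cmod_ge_0|apply pow_le, Cmod_ge_0].
    + replace (qpoch q a n) with (1 + (qpoch q a n - 1)) by ring.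
      eapply Rle_trans; [apply Cmod_triangle|]. rewrite Cmod_1.
      pose proof (qpoch_sub1_le_qbound q a n Hq). lra.
  - assert (H : is_Clim (qpoch q a) (l + 1)).
    { destruct Hl as [H1 H2]; split; apply is_lim_seq_incr_1.
      - apply is_lim_seq_ext with
          (fun n => sum_n (fun n => Re (qpoch q a (S n) - qpoch q a n)) n + 1)%R.
        + induction n as [|n IH].
          * rewrite sum_O; simpl; ring.
          * rewrite sum_Sn; unfold plus; cbn [Hierarchy.AbelianMonoid.sort] in *.
            simpl in *; lra.
        + now apply (is_lim_seq_plus' _ _ (Re l) 1); [|apply is_lim_seq_const].
      - apply is_lim_seq_ext with
          (fun n => sum_n (fun n => Im (qpoch q a (S n) - qpoch q a n)) n + 0)%R.
        + induction n as [|n IH].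
          * rewrite sum_O; simpl; ring.
          * rewrite sum_Sn; unfold plus; simpl in *; lra.
        + now apply (is_lim_seq_plus' _ _ (Im l) 0); [|apply is_lim_seq_const]. }
    unfold qpoch_inf; now rewrite (is_Clim_unique _ _ H).
Qed.

Lemma Cmult_neq_0_inv (z w : C) : z * w <> 0 -> z <> 0 /\ w <> 0.
Proof. intros H; split; intros E; apply H; rewrite E; ring. Qed.

Lemma qpoch_split (q a : C) (n m : nat) :
  qpoch q a (m + n) = qpoch q a n * qpoch q (a * q ^ n) m.
Proof.
  induction m as [|m IH]; simpl; [ring|].
  rewrite IH, Cpow_add_r; ring.
Qed.

Lemma qpoch_inf_split (q a : C) (n : nat) :
  (Cmod q < 1)%R -> qpoch_inf q a = qpoch q a n * qpoch_inf q (a * q ^ n).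
Proof.
  intros Hq.
  rewrite <- (is_Clim_unique (fun m => qpoch q a (m + n)) (qpoch_inf q a)).
  - apply is_Clim_unique.
    eapply is_Clim_ext; [intros m; symmetry; apply qpoch_split|].
    apply is_Clim_mult; [apply is_Clim_const|now apply is_Clim_qpoch].
  - destruct (is_Clim_qpoch q a Hq) as [H1 H2].
    split; [apply (is_lim_seq_incr_n (fun m => Re (qpoch q a m)) n)
           |apply (is_lim_seq_incr_n (fun m => Im (qpoch q a m)) n)]; assumption.
Qed.

Lemma qpoch_inf_step (q a : C) :
  (Cmod q < 1)%R -> qpoch_inf q a = (1 - a) * qpoch_inf q (q * a).
Proof.
  intros Hq; rewrite (qpoch_inf_split q a 1 Hq); simpl.
  replace (a * (q * 1)) with (q * a) by ring. ring.
Qed.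

Lemma qpoch_inf_1 (q : C) : (Cmod q < 1)%R -> qpoch_inf q 1 = 0.
Proof. intros Hq; rewrite qpoch_inf_step by exact Hq; ring. Qed.

Lemma qpoch_inf_neq0_step (q a : C) :
  (Cmod q < 1)%R -> qpoch_inf q a <> 0 -> 1 - a <> 0 /\ qpoch_inf q (q * a) <> 0.
Proof.
  intros Hq; rewrite (qpoch_inf_step q a Hq); intros H.
  exact (Cmult_neq_0_inv _ _ H).
Qed.

Lemma Rabs_lim_le (u : nat -> R) (l c M : R) :
  (forall n, Rabs (u n - c) <= M)%R -> is_lim_seq u l -> (Rabs (l - c) <= M)%R.
Proof.
  intros Hu Hl.
  apply (is_lim_seq_le (fun n => Rabs (u n - c)) (fun _ => M) (Rabs (l - c)) M);
    [exact Hu| |apply is_lim_seq_const].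
  apply (is_lim_seq_abs (fun n => u n - c)%R (l - c)%R).
  apply is_lim_seq_minus'; [exact Hl|apply is_lim_seq_const].
Qed.

(** The bound on [(a; q)_n - 1] is uniform in [n], so it passes to the infinite product,
    and [qbound q (a q^n) - 1] tends to 0. *)
Lemma is_Clim_qpoch_inf_pow (q a : C) :
  (Cmod q < 1)%R -> is_Clim (fun n => qpoch_inf q (a * q ^ n)) 1.
Proof.
  intros Hq.
  assert (L : is_lim_seq (fun n => qbound q (a * q ^ n) - 1)%R 0).
  { replace 0%R with (exp 0 - 1)%R by (rewrite exp_0; ring).
    apply is_lim_seq_minus'; [|apply is_lim_seq_const].
    apply (is_lim_seq_continuous exp (fun n => Cmod (a * q ^ n) / (1 - Cmod q))%R 0).
    - apply derivable_continuous_pt, derivable_pt_exp.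
    - apply is_lim_seq_ext with (fun n => Cmod a / (1 - Cmod q) * Cmod q ^ n)%R.
      { intros n; rewrite Cmod_mult, Cmod_pow; field; lra. }
      replace 0%R with (Cmod a / (1 - Cmod q) * 0)%R by ring.
      apply is_lim_seq_mult'; [apply is_lim_seq_const|].
      apply is_lim_seq_geom; rewrite Rabs_pos_eq; [exact Hq|apply Cmod_ge_0]. }
  (* One argument for the real and the imaginary part: [f] is either of them. *)
  assert (B : forall f : C -> R,
    (forall z w : C, f (z - w)%C = (f z - f w)%R) -> (forall z, Rabs (f z) <= Cmod z)%R ->
    (forall n, is_lim_seq (fun m => f (qpoch q (a * q ^ n) m))
                 (f (qpoch_inf q (a * q ^ n)))) ->
    is_lim_seq (fun n => f (qpoch_inf q (a * q ^ n))) (f 1)).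
  { intros f Hf1 Hf2 Hf3.
    assert (E : is_lim_seq (fun n => f (qpoch_inf q (a * q ^ n)) - f 1)%R 0).
    { apply is_lim_seq_abs_0.
      apply (is_lim_seq_le_le (fun _ => 0%R) _ (fun n => qbound q (a * q ^ n) - 1)%R);
        [|apply is_lim_seq_const|exact L].
      intros n; split; [apply Rabs_pos|].
      eapply Rabs_lim_le; [|apply Hf3].
      intros m; cbv beta; rewrite <- Hf1. eapply Rle_trans; [apply Hf2|].
      now apply qpoch_sub1_le_qbound. }
    apply (is_lim_seq_ext (fun n => (f (qpoch_inf q (a * q ^ n)) - f 1) + f 1)%R);
      [intros n; ring|].
    replace (Finite (f 1)) with (Finite (0 + f 1)) by (f_equal; ring).
    apply is_lim_seq_plus'; [exact E|apply is_lim_seq_const]. }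
  split.
  - apply (B Re); [reflexivity|apply Re_le_Cmod|].
    intros n; exact (proj1 (is_Clim_qpoch q (a * q ^ n) Hq)).
  - apply (B Im); [reflexivity|apply Im_le_Cmod|].
    intros n; exact (proj2 (is_Clim_qpoch q (a * q ^ n) Hq)).
Qed.

(** Some tail [(a q^n; q)_oo] is close to 1, hence non-zero. *)
Lemma qpoch_inf_neq0 (q a : C) :
  (Cmod q < 1)%R -> (forall n, qpoch q a n <> 0) -> qpoch_inf q a <> 0.
Proof.
  intros Hq Hn.
  destruct (is_Clim_qpoch_inf_pow q a Hq) as [H _].
  apply is_lim_seq_spec in H.
  destruct (H (mkposreal 1 Rlt_0_1)) as [N HN].
  specialize (HN N (Nat.le_refl N)); cbv beta in HN.
  rewrite (qpoch_inf_split q a N Hq); apply Cmult_neq_0; [apply Hn|]; intros E.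
  rewrite E in HN; simpl in HN.
  rewrite Rabs_left in HN; lra.
Qed.

(** * Lists of parameters *)

Definition qshift (q : C) (n : nat) (s : list C) : list C := map (fun a => a * q ^ n) s.

Lemma Cprod_app (s s' : list C) : Cprod (s ++ s') = Cprod s * Cprod s'.
Proof.
  unfold Cprod; induction s as [|a s IH]; simpl; [ring|]. rewrite IH; ring.
Qed.

Lemma qpochs_inf_split (q : C) (s : list C) (n : nat) :
  (Cmod q < 1)%R ->
  qpochs_inf q s = Cprod (map (fun a => qpoch q a n) s) * qpochs_inf q (qshift q n s).
Proof.
  intros Hq; unfold qpochs_inf, Cprod; induction s as [|a s IH]; simpl; [ring|].
  rewrite IH, (qpoch_inf_split q a n Hq); ring.
Qed.

Lemma is_Clim_qpochs_inf (q : C) (s : list C) :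
  (Cmod q < 1)%R -> is_Clim (fun n => qpochs_inf q (qshift q n s)) 1.
Proof.
  intros Hq; unfold qpochs_inf, Cprod; induction s as [|a s IH]; simpl.
  - apply is_Clim_const.
  - generalize (is_Clim_mult _ _ _ _ (is_Clim_qpoch_inf_pow q a Hq) IH).
    now rewrite Cmult_1_l.
Qed.

Lemma qpochs_inf_neq0 (q : C) (s : list C) :
  (Cmod q < 1)%R ->
  (forall n, Cprod (map (fun a => qpoch q a n) s) <> 0) -> qpochs_inf q s <> 0.
Proof.
  intros Hq; unfold qpochs_inf, Cprod; induction s as [|a s IH]; simpl; intros H.
  - intros E; injection E; lra.
  - apply Cmult_neq_0.
    + apply qpoch_inf_neq0; [exact Hq|]. intros n E; apply (H n); rewrite E; ring.
    + apply IH. intros n E; apply (H n); rewrite E; ring.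
Qed.

Lemma phi_den_app (q : C) (cs : list C) (n : nat) :
  phi_den q cs n = Cprod (map (fun c => qpoch q c n) (cs ++ [q])).
Proof. rewrite map_app, Cprod_app; unfold phi_den; simpl; ring. Qed.

(** Multiplying the [n]-th term of the series by the prefactor replaces every finite
    product [(a; q)_n] by the tail [(a q^n; q)_oo] on the other side of the fraction.
    The tails tend to 1, which gives convergence of the series with argument [q]; the
    numerator of the prefactor is non-zero, so convergence transfers back to [phi]. *)
Lemma is_Cseries_phi (q : C) (aa cs : list C) :
  (Cmod q < 1)%R -> no_zero_den q aa cs ->
  is_Cseries
    (fun n => qpochs_inf q (qshift q n (cs ++ [q])) / qpochs_inf q (qshift q n aa)
              * q ^ n)
    (qpochs_inf q (cs ++ [q]) / qpochs_inf q aa * phi aa cs q q).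
Proof.
  intros Hq [Ha Hc].
  set (P := qpochs_inf q (cs ++ [q])); set (A := qpochs_inf q aa) in *.
  assert (HP : P <> 0).
  { apply qpochs_inf_neq0; [exact Hq|].
    intros n; rewrite <- phi_den_app; apply Hc. }
  set (w := fun n => qpochs_inf q (qshift q n (cs ++ [q])) / qpochs_inf q (qshift q n aa)).
  assert (Hw : is_Clim w (1 / 1)).
  { apply is_Clim_div; [|now apply is_Clim_qpochs_inf|now apply is_Clim_qpochs_inf].
    intros E; injection E; lra. }
  destruct (ex_Cseries_mult_geom q w _ Hq Hw) as [S HS].
  assert (E : phi aa cs q q = / (P / A) * S).
  { apply is_Cseries_unique.
    eapply is_Cseries_ext; [|exact (is_Cseries_scal _ _ _ HS)].
    intros n; unfold w; cbv beta. rewrite phi_den_app.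
    generalize (qpochs_inf_split q (cs ++ [q]) n Hq).
    generalize (qpochs_inf_split q aa n Hq).
    generalize (Hc n); rewrite phi_den_app. fold P A.
    generalize (Cprod (map (fun c => qpoch q c n) (cs ++ [q]))) as cn.
    generalize (qpochs_inf q (qshift q n (cs ++ [q]))) as ci.
    generalize (Cprod (map (fun a => qpoch q a n) aa)) as an.
    generalize (qpochs_inf q (qshift q n aa)) as ai.
    intros ai an ci cn Hcn EA EP.
    rewrite EA in Ha; rewrite EP in HP. rewrite EA, EP.
    apply Cmult_neq_0_inv in Ha as [? ?]; apply Cmult_neq_0_inv in HP as [? ?].
    field; repeat split; assumption. }
  rewrite E. replace (P / A * (/ (P / A) * S)) with S; [exact HS|].
  field; now split.
Qed.

(** * The telescoping identity *)

(** The equation for [G(x) = x^alpha g(x)] has the coefficient [cubic b x] at [G(x/q)],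
    [q * cubic d x] at [G(qx)] and [middle] at [G(x)]. The powers of [q] of half the sum
    of all [h_i] and [l_i] in the equation for [g] are hidden in [q Lam d_1 d_2 d_3],
    which is that power times [t_1 t_2 t_3]. *)
Definition cubic (c : idx -> C) (x : C) : C := (x - c i1) * (x - c i2) * (x - c i3).

Definition middle (q Lam : C) (b d : idx -> C) (x : C) : C :=
  - (q + 1) * x ^ 3
  + (b i1 + q * d i1 + (b i2 + q * d i2) + (b i3 + q * d i3)) * x ^ 2
  - q * Lam * (d i1 * d i2 * d i3)
    * (q / b i1 + / d i1 + (q / b i2 + / d i2) + (q / b i3 + / d i3)) * x
  + q * Lam * (d i1 * d i2 * d i3) * (q + 1).

(** What remains of [summand_telescopes] once the infinite products common to all terms
    are divided out. The factor [q d_1 d_2 d_3 (1 - Lam) x] is read off at [s = x], where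
    only one term survives on each side. The balancing condition serves to eliminate
    [b_3]. *)
Lemma telescoping_polynomial (q Lam : C) (b d : idx -> C) (x s : C) :
  q <> 0 -> Lam <> 0 -> x <> 0 -> (forall i, b i <> 0) -> (forall i, d i <> 0) ->
  q * q * Lam * Lam * (d i1 * d i2 * d i3) = b i1 * b i2 * b i3 ->
  s * (cubic b x * ((1 - s / x) * (1 - q * s / x))
       + q * cubic d x * ((1 - Lam * s / x) * (1 - q * Lam * s / x))
       + middle q Lam b d x * ((1 - s / x) * (1 - q * Lam * s / x)))
  = q * (d i1 * d i2 * d i3) * (1 - Lam) * x
    * ((1 - s / x) * ((1 - q * Lam * s / b i1) * (1 - q * Lam * s / b i2)
                      * (1 - q * Lam * s / b i3))
       - (1 - q * Lam * s / x) * ((1 - s / d i1) * (1 - s / d i2) * (1 - s / d i3))).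
Proof.
  intros Hq HL Hx Hb Hd E. unfold cubic, middle.
  generalize (Hb i1), (Hb i2), (Hb i3), (Hd i1), (Hd i2), (Hd i3). revert E.
  generalize (b i1), (b i2), (b i3), (d i1), (d i2), (d i3).
  intros b1 b2 b3 d1 d2 d3 E H1 H2 H3 H4 H5 H6.
  assert (E3 : b3 = q * q * Lam * Lam * (d1 * d2 * d3) / (b1 * b2))
    by (rewrite E; field; auto).
  subst b3. clear E H3. field; repeat split; assumption.
Qed.

(** The analogue at the end [s = x/Lam] of the moving lattice, where the term at
    [qx] is missing and there is an additional term at [s/q] from the sum at [x/q]. *)
Lemma telescoping_polynomial_edge (q Lam : C) (b d : idx -> C) (x : C) :
  q <> 0 -> Lam <> 0 -> x <> 0 -> (forall i, b i <> 0) -> (forall i, d i <> 0) ->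
  q * q * Lam * Lam * (d i1 * d i2 * d i3) = b i1 * b i2 * b i3 ->
  let s := x / Lam in
  - (b i1 * b i2 * b i3) * (s / q) * (1 - q)
      * ((1 - s / d i1) * (1 - s / d i2) * (1 - s / d i3))
  + s * cubic b x * (1 - q / Lam) + s * middle q Lam b d x * (1 - q)
  = q * (d i1 * d i2 * d i3) * (1 - Lam) * x
    * ((1 - q * Lam * s / b i1) * (1 - q * Lam * s / b i2) * (1 - q * Lam * s / b i3)).
Proof.
  intros Hq HL Hx Hb Hd E s. unfold s, cubic, middle.
  generalize (Hb i1), (Hb i2), (Hb i3), (Hd i1), (Hd i2), (Hd i3). revert E.
  generalize (b i1), (b i2), (b i3), (d i1), (d i2), (d i3).
  intros b1 b2 b3 d1 d2 d3 E H1 H2 H3 H4 H5 H6.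
  assert (E3 : b3 = q * q * Lam * Lam * (d1 * d2 * d3) / (b1 * b2))
    by (rewrite E; field; auto).
  subst b3. clear E H3. field; repeat split; assumption.
Qed.

Definition kernel (q Lam : C) (b d : idx -> C) (y s : C) : C :=
  qpochs_inf q [q * Lam * s / y; q * s / d i1; q * s / d i2; q * s / d i3]
  / qpochs_inf q [q * s / y; q * Lam * s / b i1; q * Lam * s / b i2; q * Lam * s / b i3].

Definition antidifference (q Lam : C) (b d : idx -> C) (x s : C) : C :=
  qpochs_inf q [q * Lam * s / x; s / d i1; s / d i2; s / d i3]
  / qpochs_inf q [s / x; q * Lam * s / b i1; q * Lam * s / b i2; q * Lam * s / b i3].

Definition summand (q Lam : C) (b d : idx -> C) (x s : C) : C :=
  s * (cubic b x * kernel q Lam b d (x / q) s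
       + q * cubic d x * kernel q Lam b d (q * x) s
       + middle q Lam b d x * kernel q Lam b d x s).

(** Every product is written as a few linear factors times its value at the most shifted
    argument that occurs; these values are common to all terms, and dividing by them
    leaves [telescoping_polynomial]. *)
Lemma summand_telescopes (q Lam : C) (b d : idx -> C) (x s : C) :
  (Cmod q < 1)%R ->
  q <> 0 -> Lam <> 0 -> x <> 0 -> (forall i, b i <> 0) -> (forall i, d i <> 0) ->
  q * q * Lam * Lam * (d i1 * d i2 * d i3) = b i1 * b i2 * b i3 ->
  qpoch_inf q (s / x) <> 0 -> (forall i, qpoch_inf q (q * Lam * s / b i) <> 0) ->
  summand q Lam b d x s
  = q * (d i1 * d i2 * d i3) * (1 - Lam) * x
    * (antidifference q Lam b d x (q * s) - antidifference q Lam b d x s).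
Proof.
  intros Hq Hq0 HL Hx Hb Hd E Hs Hbs.
  pose proof (telescoping_polynomial q Lam b d x s Hq0 HL Hx Hb Hd E) as P.
  apply qpoch_inf_neq0_step in Hs as [HU0 Hs]; [|exact Hq].
  apply qpoch_inf_neq0_step in Hs as [HU1 Hs]; [|exact Hq].
  pose proof (fun i => proj1 (qpoch_inf_neq0_step q _ Hq (Hbs i))) as HB.
  pose proof (fun i => proj2 (qpoch_inf_neq0_step q _ Hq (Hbs i))) as Hr.
  clear Hbs E.
  unfold summand, kernel, antidifference, qpochs_inf, Cprod; simpl.
  replace (q * Lam * s / (x / q)) with (q * (q * (Lam * s / x))) by (field; auto).
  replace (q * s / (x / q)) with (q * (q * (s / x))) by (field; auto).
  replace (q * Lam * s / (q * x)) with (Lam * s / x) by (field; auto).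
  replace (q * s / (q * x)) with (s / x) by (field; auto).
  replace (q * Lam * (q * s) / x) with (q * (q * (Lam * s / x))) by (field; auto).
  replace (q * Lam * s / x) with (q * (Lam * s / x)) in * by (field; auto).
  replace (q * s / x) with (q * (s / x)) in * by (field; auto).
  replace (q * Lam * (q * s) / b i1) with (q * (q * Lam * s / b i1)) by (field; auto).
  replace (q * Lam * (q * s) / b i2) with (q * (q * Lam * s / b i2)) by (field; auto).
  replace (q * Lam * (q * s) / b i3) with (q * (q * Lam * s / b i3)) by (field; auto).
  replace (q * s / d i1) with (q * (s / d i1)) by (field; auto).
  replace (q * s / d i2) with (q * (s / d i2)) by (field; auto).
  replace (q * s / d i3) with (q * (s / d i3)) by (field; auto).
  rewrite (qpoch_inf_step q (s / x) Hq), (qpoch_inf_step q (q * (s / x)) Hq),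
    (qpoch_inf_step q (Lam * s / x) Hq), (qpoch_inf_step q (q * (Lam * s / x)) Hq),
    (qpoch_inf_step q (s / d i1) Hq), (qpoch_inf_step q (s / d i2) Hq),
    (qpoch_inf_step q (s / d i3) Hq), (qpoch_inf_step q (q * Lam * s / b i1) Hq),
    (qpoch_inf_step q (q * Lam * s / b i2) Hq), (qpoch_inf_step q (q * Lam * s / b i3) Hq).
  generalize (HB i1), (HB i2), (HB i3), (Hr i1), (Hr i2), (Hr i3).
  revert HU0 HU1 Hs P. clear.
  generalize (1 - s / x), (1 - q * (s / x)), (1 - Lam * s / x),
    (1 - q * (Lam * s / x)), (1 - s / d i1), (1 - s / d i2), (1 - s / d i3),
    (1 - q * Lam * s / b i1), (1 - q * Lam * s / b i2), (1 - q * Lam * s / b i3).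
  generalize (qpoch_inf q (q * (q * (s / x)))), (qpoch_inf q (q * (q * (Lam * s / x)))),
    (qpoch_inf q (q * (s / d i1))), (qpoch_inf q (q * (s / d i2))),
    (qpoch_inf q (q * (s / d i3))), (qpoch_inf q (q * (q * Lam * s / b i1))),
    (qpoch_inf q (q * (q * Lam * s / b i2))), (qpoch_inf q (q * (q * Lam * s / b i3))).
  generalize (q * (d i1 * d i2 * d i3) * (1 - Lam) * x), (cubic b x), (cubic d x),
    (middle q Lam b d x).
  intros k cb cd m p e f1 f2 f3 r1 r2 r3 U0 U1 V0 V1 D1 D2 D3 B1 B2 B3
    HU0 HU1 Hp P HB1 HB2 HB3 Hr1 Hr2 Hr3.
  (* The prefactor is what all the terms have in common. *)
  transitivity (e * f1 * f2 * f3 / (U0 * U1 * p * B1 * B2 * B3 * r1 * r2 * r3)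
     * (s * (cb * (U0 * U1) + q * cd * (V0 * V1) + m * (U0 * V1)))).
  - field; repeat split; assumption.
  - rewrite P. field; repeat split; assumption.
Qed.

Lemma qpoch_inf_pow_neq0 (q a : C) (n : nat) :
  (Cmod q < 1)%R -> qpoch_inf q a <> 0 -> qpoch_inf q (a * q ^ n) <> 0.
Proof.
  intros Hq; rewrite (qpoch_inf_split q a n Hq); intros H.
  now apply Cmult_neq_0_inv in H.
Qed.

Lemma is_Clim_antidifference (q Lam : C) (b d : idx -> C) (x s : C) :
  (Cmod q < 1)%R -> is_Clim (fun n => antidifference q Lam b d x (s * q ^ n)) 1.
Proof.
  intros Hq; unfold antidifference.
  replace (RtoC 1) with (1 / 1) by (field; intros H; injection H; lra).
  apply is_Clim_div; [intros H; injection H; lra| |].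
  - eapply is_Clim_ext;
      [|apply (is_Clim_qpochs_inf q [q * Lam * s / x; s / d i1; s / d i2; s / d i3] Hq)].
    intros n; apply (f_equal (qpochs_inf q)); simpl.
    repeat (apply f_equal2; [unfold Cdiv; ring|]); reflexivity.
  - eapply is_Clim_ext;
      [|apply (is_Clim_qpochs_inf q
          [s / x; q * Lam * s / b i1; q * Lam * s / b i2; q * Lam * s / b i3] Hq)].
    intros n; apply (f_equal (qpochs_inf q)); simpl.
    repeat (apply f_equal2; [unfold Cdiv; ring|]); reflexivity.
Qed.

(** [G] is the Jackson integral of [f] over the lattice [s q^n], without its usual
    factor [1 - q]. *)
Definition is_jackson (q : C) (f : C -> C) (s G : C) : Prop :=
  is_Cseries (fun n => s * q ^ n * f (s * q ^ n)) G.

Lemma is_jackson_tail (q : C) (f : C -> C) (s G : C) :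
  is_jackson q f s G -> is_jackson q f (q * s) (G - s * f s).
Proof.
  unfold is_jackson; intros H.
  apply is_Cseries_tail in H; simpl in H. rewrite !Cmult_1_r in H.
  eapply is_Cseries_ext; [|exact H]. intros n; cbv beta.
  now replace (q * s * q ^ n) with (s * (q * q ^ n)) by ring.
Qed.

(** The sums at [x/q], [x] and [qx] are over the same lattice here, so they combine
    termwise and telescope. *)
Lemma jackson_equation (q Lam : C) (b d : idx -> C) (x s Gm G0 Gp : C) :
  (Cmod q < 1)%R ->
  q <> 0 -> Lam <> 0 -> x <> 0 -> (forall i, b i <> 0) -> (forall i, d i <> 0) ->
  q * q * Lam * Lam * (d i1 * d i2 * d i3) = b i1 * b i2 * b i3 ->
  qpoch_inf q (s / x) <> 0 -> (forall i, qpoch_inf q (q * Lam * s / b i) <> 0) ->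
  is_jackson q (kernel q Lam b d (x / q)) s Gm ->
  is_jackson q (kernel q Lam b d x) s G0 ->
  is_jackson q (kernel q Lam b d (q * x)) s Gp ->
  cubic b x * Gm + q * cubic d x * Gp + middle q Lam b d x * G0
  = q * (d i1 * d i2 * d i3) * (1 - Lam) * x * (1 - antidifference q Lam b d x s).
Proof.
  intros Hq Hq0 HL Hx Hb Hd E Hs Hbs Sm S0 Sp.
  assert (S1 : is_Cseries (fun n => summand q Lam b d x (s * q ^ n))
    (cubic b x * Gm + q * cubic d x * Gp + middle q Lam b d x * G0)).
  { eapply is_Cseries_ext;
      [|exact (is_Cseries_plus _ _ _ _ (is_Cseries_plus _ _ _ _
          (is_Cseries_scal (cubic b x) _ _ Sm) (is_Cseries_scal (q * cubic d x) _ _ Sp))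
          (is_Cseries_scal (middle q Lam b d x) _ _ S0))].
    intros n; unfold summand; ring. }
  set (k := q * (d i1 * d i2 * d i3) * (1 - Lam) * x).
  assert (S2 : is_Cseries (fun n => summand q Lam b d x (s * q ^ n))
    (k * (1 - antidifference q Lam b d x (s * q ^ 0)))).
  { eapply is_Cseries_ext;
      [|exact (is_Cseries_scal k _ _ (is_Cseries_telescope _ _
          (is_Clim_antidifference q Lam b d x s Hq)))].
    intros n; cbv beta. symmetry.
    replace (s * q ^ S n) with (q * (s * q ^ n)) by (simpl; ring).
    apply summand_telescopes; auto.
    - replace (s * q ^ n / x) with (s / x * q ^ n) by (field; auto).
      now apply qpoch_inf_pow_neq0.
    - intros i. replace (q * Lam * (s * q ^ n) / b i) with (q * Lam * s / b i * q ^ n)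
        by (field; auto).
      now apply qpoch_inf_pow_neq0. }
  rewrite <- (is_Cseries_unique _ _ S1), (is_Cseries_unique _ _ S2).
  simpl; now rewrite Cmult_1_r.
Qed.

(** The factor [(s/d_i; q)_oo] is [(1; q)_oo = 0] at [s = d_i]. *)
Lemma antidifference_root_eq0 (q Lam : C) (b d : idx -> C) (x : C) (i : idx) :
  (Cmod q < 1)%R -> d i <> 0 -> antidifference q Lam b d x (d i) = 0.
Proof.
  intros Hq Hd; unfold antidifference, qpochs_inf, Cprod; simpl.
  assert (H : qpoch_inf q (d i / d i) = 0).
  { replace (d i / d i) with (RtoC 1) by (field; exact Hd). now apply qpoch_inf_1. }
  unfold Cdiv at 1.
  destruct i; rewrite H; ring.
Qed.

Lemma jackson_equation_fixed (q Lam : C) (b d : idx -> C) (i : idx) (x Gm G0 Gp : C) :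
  (Cmod q < 1)%R ->
  q <> 0 -> Lam <> 0 -> x <> 0 -> (forall i, b i <> 0) -> (forall i, d i <> 0) ->
  q * q * Lam * Lam * (d i1 * d i2 * d i3) = b i1 * b i2 * b i3 ->
  qpoch_inf q (d i / x) <> 0 -> (forall j, qpoch_inf q (q * Lam * d i / b j) <> 0) ->
  is_jackson q (kernel q Lam b d (x / q)) (d i) Gm ->
  is_jackson q (kernel q Lam b d x) (d i) G0 ->
  is_jackson q (kernel q Lam b d (q * x)) (d i) Gp ->
  cubic b x * Gm + q * cubic d x * Gp + middle q Lam b d x * G0
  = q * (d i1 * d i2 * d i3) * (1 - Lam) * x.
Proof.
  intros. rewrite (jackson_equation q Lam b d x (d i) Gm G0 Gp) by assumption.
  rewrite antidifference_root_eq0 by auto. ring.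
Qed.

(** The lattice of the sum at [qx], starting at [qx/Lam], is contained in the two
    others: the sum at [x/q] has two terms more and the sum at [x] has one more. On the
    common part [jackson_equation] applies, and the three excess terms make up for the
    boundary value of the antidifference at [qx/Lam]. The statement does not follow by
    telescoping down to [s = x/Lam], because [T] has a spurious pole there when
    [Lam = 1]. *)
Lemma jackson_equation_moving (q Lam : C) (b d : idx -> C) (x Gm G0 Gp : C) :
  (Cmod q < 1)%R ->
  q <> 0 -> Lam <> 0 -> x <> 0 -> (forall i, b i <> 0) -> (forall i, d i <> 0) ->
  q * q * Lam * Lam * (d i1 * d i2 * d i3) = b i1 * b i2 * b i3 ->
  qpoch_inf q (q / Lam) <> 0 -> (forall j, qpoch_inf q (x / b j) <> 0) ->
  is_jackson q (kernel q Lam b d (x / q)) (x / q / Lam) Gm ->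
  is_jackson q (kernel q Lam b d x) (x / Lam) G0 ->
  is_jackson q (kernel q Lam b d (q * x)) (q * x / Lam) Gp ->
  cubic b x * Gm + q * cubic d x * Gp + middle q Lam b d x * G0
  = q * (d i1 * d i2 * d i3) * (1 - Lam) * x.
Proof.
  intros Hq Hq0 HL Hx Hb Hd E HqL Hxb Sm S0 Sp.
  pose proof (telescoping_polynomial_edge q Lam b d x Hq0 HL Hx Hb Hd E) as P.
  cbv zeta in P.
  apply is_jackson_tail in Sm. apply is_jackson_tail in Sm. apply is_jackson_tail in S0.
  replace (q * (q * (x / q / Lam))) with (q * x / Lam) in Sm by (field; auto).
  replace (q * (x / Lam)) with (q * x / Lam) in S0 by (field; auto).
  assert (Hb1 : forall j, 1 - x / b j <> 0)
    by (intros j; now apply (qpoch_inf_neq0_step q)).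
  assert (Hb2 : forall j, 1 - q * (x / b j) <> 0)
    by (intros j; apply (qpoch_inf_neq0_step q _ Hq), (qpoch_inf_neq0_step q _ Hq), Hxb).
  assert (Hb3 : forall j, qpoch_inf q (q * (q * (x / b j))) <> 0)
    by (intros j; apply (qpoch_inf_neq0_step q _ Hq), (qpoch_inf_neq0_step q _ Hq), Hxb).
  destruct (qpoch_inf_neq0_step q _ Hq HqL) as [HL1 HL2].
  assert (Hq1 : 1 - q <> 0).
  { intros Z. assert (Z' : q = 1) by (rewrite <- (Cplus_0_l q), <- Z; ring).
    rewrite Z', Cmod_1 in Hq; lra. }
  assert (P1 : qpoch_inf q (q * x / Lam / x) <> 0)
    by (now replace (q * x / Lam / x) with (q / Lam) by (field; auto)).
  assert (P2 : forall j, qpoch_inf q (q * Lam * (q * x / Lam) / b j) <> 0).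
  { intros j. replace (q * Lam * (q * x / Lam) / b j) with (q * (q * (x / b j)))
      by (field; auto). apply Hb3. }
  pose proof (jackson_equation q Lam b d x (q * x / Lam) _ _ _ Hq Hq0 HL Hx Hb Hd E
    P1 P2 Sm S0 Sp) as JJ.
  clear P1 P2 Sm S0 Sp.
  (* It remains to match the excess terms [u], [v], [w] with the boundary value. *)
  match type of JJ with cubic b x * (Gm - ?u - ?v) + _ + _ * (G0 - ?w) = _ =>
    assert (K : cubic b x * (u + v) + middle q Lam b d x * w =
      q * (d i1 * d i2 * d i3) * (1 - Lam) * x * antidifference q Lam b d x (q * x / Lam));
    [clear JJ|
     transitivity (cubic b x * (Gm - u - v) + q * cubic d x * Gp
       + middle q Lam b d x * (G0 - w) + (cubic b x * (u + v) + middle q Lam b d x * w));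
     [ring|rewrite JJ, K; ring]]
  end.
  replace (q * (x / q / Lam)) with (x / Lam) by (field; auto).
  unfold kernel, antidifference, qpochs_inf, Cprod; simpl.
  replace (q * Lam * (x / q / Lam) / (x / q)) with q by (field; auto).
  replace (q * (x / q / Lam) / (x / q)) with (q / Lam) by (field; auto).
  replace (q * Lam * (x / Lam) / (x / q)) with (q * q) by (field; auto).
  replace (q * (x / Lam) / (x / q)) with (q * (q / Lam)) by (field; auto).
  replace (q * Lam * (x / Lam) / x) with q by (field; auto).
  replace (q * (x / Lam) / x) with (q / Lam) by (field; auto).
  replace (q * Lam * (q * x / Lam) / x) with (q * q) by (field; auto).
  replace (q * x / Lam / x) with (q / Lam) by (field; auto).
  assert (D : forall j, q * (x / q / Lam) / d j = x / Lam / d j) by (intros; field; auto).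
  rewrite !D; clear D.
  assert (D : forall j, q * (x / Lam) / d j = q * (x / Lam / d j)) by (intros; field; auto).
  rewrite !D; clear D.
  assert (D : forall j, q * x / Lam / d j = q * (x / Lam / d j)) by (intros; field; auto).
  rewrite !D; clear D.
  assert (D : forall j, q * Lam * (x / q / Lam) / b j = x / b j) by (intros; field; auto).
  rewrite !D; clear D.
  assert (D : forall j, q * Lam * (x / Lam) / b j = q * (x / b j)) by (intros; field; auto).
  rewrite !D in *; clear D.
  assert (D : forall j, q * Lam * (q * x / Lam) / b j = q * (q * (x / b j)))
    by (intros; field; auto).
  rewrite !D; clear D.
  assert (F : cubic b x
    = - (b i1 * b i2 * b i3) * ((1 - x / b i1) * (1 - x / b i2) * (1 - x / b i3)))
    by (unfold cubic; field; auto).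
  rewrite (qpoch_inf_step q q Hq), (qpoch_inf_step q (q / Lam) Hq),
    (qpoch_inf_step q (x / Lam / d i1) Hq), (qpoch_inf_step q (x / Lam / d i2) Hq),
    (qpoch_inf_step q (x / Lam / d i3) Hq),
    (qpoch_inf_step q (x / b i1) Hq), (qpoch_inf_step q (x / b i2) Hq),
    (qpoch_inf_step q (x / b i3) Hq), (qpoch_inf_step q (q * (x / b i1)) Hq),
    (qpoch_inf_step q (q * (x / b i2)) Hq), (qpoch_inf_step q (q * (x / b i3)) Hq).
  replace (x / q / Lam) with (x / Lam / q) by (field; auto).
  generalize (Hb1 i1), (Hb1 i2), (Hb1 i3), (Hb2 i1), (Hb2 i2), (Hb2 i3),
    (Hb3 i1), (Hb3 i2), (Hb3 i3).
  revert Hq0 HL1 HL2 Hq1 F P. clear.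
  generalize (1 - q), (1 - q / Lam), (1 - x / Lam / d i1), (1 - x / Lam / d i2),
    (1 - x / Lam / d i3), (1 - x / b i1), (1 - x / b i2), (1 - x / b i3),
    (1 - q * (x / b i1)), (1 - q * (x / b i2)), (1 - q * (x / b i3)).
  generalize (qpoch_inf q (q * q)), (qpoch_inf q (q * (q / Lam))),
    (qpoch_inf q (q * (x / Lam / d i1))), (qpoch_inf q (q * (x / Lam / d i2))),
    (qpoch_inf q (q * (x / Lam / d i3))),  (qpoch_inf q (q * (q * (x / b i1)))),
    (qpoch_inf q (q * (q * (x / b i2)))), (qpoch_inf q (q * (q * (x / b i3)))).
  generalize (q * (d i1 * d i2 * d i3) * (1 - Lam) * x), (cubic b x), (b i1 * b i2 * b i3),
    (middle q Lam b d x), (x / Lam).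
  intros k cb bb m s e p f1 f2 f3 r1 r2 r3 U V D1 D2 D3 A1 A2 A3 B1 B2 B3
    Hq0 HV Hp HU F P HA1 HA2 HA3 HB1 HB2 HB3 Hr1 Hr2 Hr3.
  (* Again the prefactor is the common part of all the terms. *)
  transitivity (e * f1 * f2 * f3 / (p * V * B1 * B2 * B3 * r1 * r2 * r3)
     * (- bb * (s / q) * U * (D1 * D2 * D3) + s * cb * V + s * m * U)).
  - rewrite F. field; repeat split; assumption.
  - rewrite P. field; repeat split; assumption.
Qed.

(** * Powers of q *)

Lemma Cinv_neq_0 (z : C) : z <> 0 -> / z <> 0.
Proof.
  intros Hz; apply (Cmult_neq_0_inv z (/ z)); rewrite Cinv_r by exact Hz.
  intros E; injection E; lra.
Qed.

Lemma Cexp_plus (z w : C) : Cexp (z + w) = Cexp z * Cexp w.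
Proof.
  destruct z, w; unfold Cexp; simpl; rewrite exp_plus, cos_plus, sin_plus.
  apply injective_projections; simpl; ring.
Qed.

Lemma Cexp_0 : Cexp 0 = 1.
Proof.
  unfold Cexp; simpl; rewrite exp_0, cos_0, sin_0.
  apply injective_projections; simpl; ring.
Qed.

Lemma qpow_plus (logq a b : C) : qpow logq (a + b) = qpow logq a * qpow logq b.
Proof. unfold qpow; rewrite <- Cexp_plus; f_equal; ring. Qed.

Lemma qpow_0 (logq : C) : qpow logq 0 = 1.
Proof. unfold qpow; rewrite <- Cexp_0; f_equal; ring. Qed.

Lemma qpow_neq0 (logq a : C) : qpow logq a <> 0.
Proof.
  intros E. assert (H : qpow logq (a + - a) = 0) by (rewrite qpow_plus, E; ring).
  replace (a + - a) with (RtoC 0) in H by ring.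
  rewrite qpow_0 in H; injection H; lra.
Qed.

Lemma qpow_opp (logq a : C) : qpow logq (- a) = / qpow logq a.
Proof.
  assert (H : qpow logq (a + - a) = 1)
    by (rewrite <- (qpow_0 logq); f_equal; ring).
  rewrite qpow_plus in H.
  replace (qpow logq (- a)) with (/ qpow logq a * (qpow logq a * qpow logq (- a)))
    by (field; apply qpow_neq0).
  rewrite H; ring.
Qed.

Lemma qpow_minus (logq a b : C) : qpow logq (a - b) = qpow logq a / qpow logq b.
Proof. unfold Cminus; now rewrite qpow_plus, qpow_opp. Qed.

(** The roots of the cubic coefficients of [g(x/q)] and [g(qx)]. *)
Definition hroot (logq : C) (h t : idx -> C) (i : idx) : C := qpow logq (h i + 1/2) * t i.
Definition lroot (logq : C) (l t : idx -> C) (i : idx) : C := qpow logq (l i - 1/2) * t i.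

Lemma C2_neq0 : RtoC 2 <> 0.
Proof. intros H; injection H; lra. Qed.

Lemma qpow_1 (q logq : C) : Cexp logq = q -> qpow logq 1 = q.
Proof. intros <-; unfold qpow; f_equal; ring. Qed.

Lemma qpow_half (q logq : C) : Cexp logq = q -> qpow logq (1/2) * qpow logq (1/2) = q.
Proof.
  intros H; rewrite <- qpow_plus, <- (qpow_1 q logq H); f_equal; field; apply C2_neq0.
Qed.

Lemma hroot_neq0 (logq : C) (h t : idx -> C) (i : idx) : t i <> 0 -> hroot logq h t i <> 0.
Proof. intros H; apply Cmult_neq_0; [apply qpow_neq0|exact H]. Qed.

Lemma lroot_neq0 (logq : C) (l t : idx -> C) (i : idx) : t i <> 0 -> lroot logq l t i <> 0.
Proof. intros H; apply Cmult_neq_0; [apply qpow_neq0|exact H]. Qed.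

(** Comparison of exponents: [2 + 2 lambda + (l_1 + l_2 + l_3) - 3/2] equals
    [h_1 + h_2 + h_3 + 3/2]. *)
Lemma root_balance (q logq : C) (h l t : idx -> C) :
  Cexp logq = q ->
  let Lam := qpow logq (lam h l) in
  let b := hroot logq h t in
  let d := lroot logq l t in
  q * q * Lam * Lam * (d i1 * d i2 * d i3) = b i1 * b i2 * b i3.
Proof.
  intros H; cbv zeta; unfold hroot, lroot. rewrite <- (qpow_1 q logq H).
  transitivity (qpow logq (1 + 1 + lam h l + lam h l + (l i1 - 1/2) + (l i2 - 1/2)
    + (l i3 - 1/2)) * (t i1 * t i2 * t i3)).
  - rewrite !qpow_plus; ring.
  - replace (1 + 1 + lam h l + lam h l + (l i1 - 1/2) + (l i2 - 1/2) + (l i3 - 1/2))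
      with (h i1 + 1/2 + (h i2 + 1/2) + (h i3 + 1/2))
      by (unfold lam; field; apply C2_neq0).
    rewrite (qpow_plus _ (h i1 + 1/2 + (h i2 + 1/2))), (qpow_plus _ (h i1 + 1/2)); ring.
Qed.

Lemma xpow_1_minus (logx : C -> C) (x a : C) :
  Cexp (logx x) = x -> xpow logx x (1 - a) = x * xpow logx x (- a).
Proof.
  intros Hx; unfold xpow. rewrite <- Hx at 2. rewrite <- Cexp_plus; f_equal; ring.
Qed.

(** Both solutions have the form [x^(-alpha) G(x)]. The factors [q^alpha] and
    [q^(-alpha)] that the power contributes at [x/q] and [qx] balance the powers
    [q^alpha] and [q^(2 alpha)] in the coefficients, so [alpha] disappears from
    the equation for [G]. *)
Lemma satisfies_of_jackson_equation (q logq : C) (logx : C -> C) (h l t : idx -> C)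
    (alpha : C) (g : C -> C) (x Gm G0 Gp : C) :
  Cexp logq = q ->
  (forall y : C, y <> 0 -> Cexp (logx y) = y) ->
  (forall (y a : C) (n : Z), y <> 0 ->
     xpow logx (qpow logq (IZR n) * y) a = qpow logq (IZR n * a) * xpow logx y a) ->
  (forall i, t i <> 0) -> x <> 0 ->
  g (x / q) = xpow logx (x / q) (- alpha) * Gm ->
  g x = xpow logx x (- alpha) * G0 ->
  g (q * x) = xpow logx (q * x) (- alpha) * Gp ->
  let Lam := qpow logq (lam h l) in
  let b := hroot logq h t in
  let d := lroot logq l t in
  cubic b x * Gm + q * cubic d x * Gp + middle q Lam b d x * G0
  = q * (d i1 * d i2 * d i3) * (1 - Lam) * x ->
  satisfies q logq logx h l t alpha g x.
Proof.
  intros Hq Hlog Hbr Ht Hx Em E0 Ep Lam b d J.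
  pose proof (Hbr x (- alpha) (-1)%Z Hx) as Bm.
  pose proof (Hbr x (- alpha) 1%Z Hx) as Bp.
  replace (qpow logq (IZR (-1)) * x) with (x / q) in Bm.
  2:{ rewrite <- (qpow_1 q logq Hq). change (IZR (-1)) with (- (1))%R.
      rewrite RtoC_opp, qpow_opp; field; apply qpow_neq0. }
  replace (qpow logq (IZR 1) * x) with (q * x) in Bp by now rewrite (qpow_1 q logq Hq).
  replace (IZR (-1) * - alpha) with alpha in Bm
    by (change (IZR (-1)) with (- (1))%R; rewrite RtoC_opp; ring).
  replace (1 * - alpha) with (- alpha) in Bp by ring. rewrite qpow_opp in Bp.
  pose proof (xpow_1_minus logx x alpha (Hlog x Hx)) as Bx.
  unfold satisfies; cbv zeta.
  rewrite Em, E0, Ep, Bm, Bp, Bx. clear Em E0 Ep Bm Bp Bx Hlog Hbr.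
  generalize (xpow logx x (- alpha)); intros A.
  replace (qpow logq ((h i1 + h i2 + h i3 + l i1 + l i2 + l i3 + 1) / 2))
    with (Lam * (qpow logq (l i1) * qpow logq (l i2) * qpow logq (l i3)))
    by (unfold Lam, lam; rewrite <- !qpow_plus; f_equal; field; apply C2_neq0).
  replace (qpow logq ((h i1 + h i2 + h i3 + l i1 + l i2 + l i3) / 2))
    with (Lam * (qpow logq (l i1) * qpow logq (l i2) * qpow logq (l i3))
          / qpow logq (1/2))
    by (unfold Lam, lam; rewrite <- !qpow_plus, <- qpow_minus; f_equal; field;
        apply C2_neq0).
  replace (qpow logq (2 * alpha + 1)) with (qpow logq alpha * qpow logq alpha * q)
    by (rewrite <- (qpow_1 q logq Hq), <- !qpow_plus; f_equal; ring).
  fold Lam.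
  transitivity (qpow logq alpha * A *
    (cubic b x * Gm + q * cubic d x * Gp + middle q Lam b d x * G0
     - q * (d i1 * d i2 * d i3) * (1 - Lam) * x)); [|rewrite J; ring].
  clear J. unfold cubic, middle, b, d, hroot, lroot.
  rewrite !qpow_minus, !qpow_plus, !qpow_opp.
  rewrite <- (qpow_half q logq Hq).
  generalize (qpow_neq0 logq (1/2)), (qpow_neq0 logq alpha),
    (qpow_neq0 logq (h i1)), (qpow_neq0 logq (h i2)), (qpow_neq0 logq (h i3)),
    (qpow_neq0 logq (l i1)), (qpow_neq0 logq (l i2)), (qpow_neq0 logq (l i3)).
  generalize (qpow logq (1/2)), (qpow logq alpha),
    (qpow logq (h i1)), (qpow logq (h i2)), (qpow logq (h i3)),
    (qpow logq (l i1)), (qpow logq (l i2)), (qpow logq (l i3)).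
  generalize (Ht i1), (Ht i2), (Ht i3). generalize (t i1), (t i2), (t i3).
  intros. field; repeat split; assumption.
Qed.

(** * The two families of solutions *)

(** The hypotheses on [aa] and [cs ++ [q]] say that they list the parameters of the
    kernel in some order; this is phrased through products because products are all that
    is ever formed from the lists. *)
Lemma is_jackson_kernel (q Lam : C) (b d : idx -> C) (y s : C) (aa cs : list C) :
  (Cmod q < 1)%R ->
  (forall f : C -> C, Cprod (map f aa) = Cprod (map f
     [q * s / y; q * Lam * s / b i1; q * Lam * s / b i2; q * Lam * s / b i3])) ->
  (forall f : C -> C, Cprod (map f (cs ++ [q])) = Cprod (map f
     [q * Lam * s / y; q * s / d i1; q * s / d i2; q * s / d i3])) ->
  no_zero_den q aa cs ->
  is_jackson q (kernel q Lam b d y) s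
    (s * (qpochs_inf q (cs ++ [q]) / qpochs_inf q aa * phi aa cs q q)).
Proof.
  intros Hq Ea Ec Hz. unfold is_jackson.
  eapply is_Cseries_ext; [|exact (is_Cseries_scal s _ _ (is_Cseries_phi q aa cs Hq Hz))].
  intros n; unfold qshift, qpochs_inf; rewrite !map_map, Ea, Ec.
  rewrite (Cmult_comm _ (q ^ n)), Cmult_assoc; apply f_equal.
  unfold kernel, qpochs_inf; cbn [map].
  apply f_equal2; apply (f_equal Cprod);
    repeat (apply f_equal2; [apply f_equal; unfold Cdiv; ring|]); reflexivity.
Qed.

Lemma no_zero_den_upper (q : C) (aa cs : list C) (a : C) :
  no_zero_den q aa cs -> In a aa -> qpoch_inf q a <> 0.
Proof.
  intros [H _]; revert H; unfold qpochs_inf, Cprod.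
  induction aa as [|a' s IH]; simpl; intros H Ha; [easy|].
  apply Cmult_neq_0_inv in H as [H1 H2].
  destruct Ha as [<-|Ha]; auto.
Qed.

Lemma upper_i_roots (q logq : C) (h l t : idx -> C) (i j k : idx) (y : C) :
  Cexp logq = q -> (forall i, t i <> 0) -> y <> 0 ->
  let Lam := qpow logq (lam h l) in
  let b := hroot logq h t in
  let d := lroot logq l t in
  upper_i logq h l t i j k y
  = [q * d i / y; q * Lam * d i / b i; q * Lam * d i / b j; q * Lam * d i / b k].
Proof.
  intros Hq Ht Hy Lam b d; unfold upper_i, b, d, hroot, lroot, Lam.
  rewrite !qpow_minus, !qpow_plus, <- (qpow_half q logq Hq).
  repeat (apply f_equal2; [field; auto 7 using qpow_neq0|]); reflexivity.
Qed.

Lemma lower_i_roots (q logq : C) (h l t : idx -> C) (i j k : idx) (y : C) :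
  Cexp logq = q -> (forall i, t i <> 0) -> y <> 0 ->
  let Lam := qpow logq (lam h l) in
  let d := lroot logq l t in
  lower_i logq h l t i j k y ++ [q]
  = [q * Lam * d i / y; q * d i / d j; q * d i / d k; q * d i / d i].
Proof.
  intros Hq Ht Hy Lam d; unfold lower_i, d, lroot, Lam; simpl.
  rewrite !qpow_plus, !qpow_minus, (qpow_1 q logq Hq), <- (qpow_half q logq Hq).
  repeat (apply f_equal2; [field; auto 7 using qpow_neq0|]); reflexivity.
Qed.

Lemma qpow_3half (q logq : C) : Cexp logq = q -> qpow logq (3/2) = q * qpow logq (1/2).
Proof.
  intros H; rewrite <- (qpow_1 q logq H) at 1; rewrite <- qpow_plus; f_equal.
  field; apply C2_neq0.
Qed.

Lemma upper_0_roots (q logq : C) (h l t : idx -> C) (y : C) :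
  Cexp logq = q -> (forall i, t i <> 0) -> y <> 0 ->
  let Lam := qpow logq (lam h l) in
  let b := hroot logq h t in
  let s := y / Lam in
  upper_0 logq h l t y
  = [q * Lam * s / b i1; q * Lam * s / b i2; q * Lam * s / b i3; q * s / y].
Proof.
  intros Hq Ht Hy Lam b s; unfold upper_0, s, b, hroot, Lam.
  rewrite !qpow_plus, !qpow_opp, (qpow_1 q logq Hq), <- (qpow_half q logq Hq).
  repeat (apply f_equal2; [field; auto 7 using qpow_neq0|]); reflexivity.
Qed.

Lemma lower_0_roots (q logq : C) (h l t : idx -> C) (y : C) :
  Cexp logq = q -> (forall i, t i <> 0) -> y <> 0 ->
  let Lam := qpow logq (lam h l) in
  let d := lroot logq l t in
  let s := y / Lam in
  lower_0 logq h l t y ++ [q]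
  = [q * s / d i1; q * s / d i2; q * s / d i3; q * Lam * s / y].
Proof.
  intros Hq Ht Hy Lam d s; unfold lower_0, s, d, lroot, Lam; simpl.
  rewrite !qpow_plus, !qpow_minus, !qpow_opp, (qpow_3half q logq Hq),
    <- (qpow_half q logq Hq).
  repeat (apply f_equal2; [field; auto 7 using qpow_neq0|]); reflexivity.
Qed.

Lemma Cprod_map_perm (i j k : idx) (f : C -> C) (u v : C) (c : idx -> C) :
  i <> j -> i <> k -> j <> k ->
  Cprod (map f [u; c i; c j; c k]) = Cprod (map f [u; c i1; c i2; c i3])
  /\ Cprod (map f [u; c j; c k; c i]) = Cprod (map f [u; c i1; c i2; c i3]).
Proof.
  intros; unfold Cprod; simpl; destruct i, j, k; try congruence; split; ring.
Qed.

Theorem theorem4p9 :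
  forall (q logq : C) (logx : C -> C) (h l t : idx -> C) (alpha : C),
  (0 < Cmod q < 1)%R ->
  Cexp logq = q ->
  (forall x : C, x <> 0 -> Cexp (logx x) = x) ->
  (forall (x a : C) (n : Z), x <> 0 ->
     xpow logx (qpow logq (IZR n) * x) a = qpow logq (IZR n * a) * xpow logx x a) ->
  (forall i : idx, t i <> 0) ->
  (forall i j : idx, i <> j -> t i <> t j) ->
  (forall i j k : idx, i <> j -> i <> k -> j <> k ->
   forall x : C, x <> 0 ->
     (forall y : C, In y [x / q; x; q * x] ->
        no_zero_den q (upper_i logq h l t i j k y) (lower_i logq h l t i j k y)) ->
     satisfies q logq logx h l t alpha (g_i q logq logx h l t alpha i j k) x)
  /\
  (forall x : C, x <> 0 ->
     (forall y : C, In y [x / q; x; q * x] ->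
        no_zero_den q (upper_0 logq h l t y) (lower_0 logq h l t y)) ->
     satisfies q logq logx h l t alpha (g_0 q logq logx h l t alpha) x).
Proof.
  intros q logq logx h l t alpha [Hq0' Hq] Hlogq Hlogx Hbr Ht _.
  assert (Hq0 : q <> 0) by now apply Cmod_gt_0.
  set (Lam := qpow logq (lam h l)).
  set (b := hroot logq h t).
  set (d := lroot logq l t).
  assert (HL : Lam <> 0) by apply qpow_neq0.
  assert (Hb : forall i, b i <> 0) by (intros i; now apply hroot_neq0).
  assert (Hd : forall i, d i <> 0) by (intros i; now apply lroot_neq0).
  pose proof (root_balance q logq h l t Hlogq : q * q * Lam * Lam * (d i1 * d i2 * d i3)
    = b i1 * b i2 * b i3) as Hbd.
  assert (Hne : forall x : C, x <> 0 -> x / q <> 0 /\ q * x <> 0).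
  { intros x Hx; split; apply Cmult_neq_0; auto using Cinv_neq_0. }
  split.
  - intros i j k Hij Hik Hjk x Hx Hz.
    destruct (Hne x Hx) as [Hxm Hxp].
    set (J y := d i * (qpochs_inf q (lower_i logq h l t i j k y ++ [q])
                       / qpochs_inf q (upper_i logq h l t i j k y)
                       * phi (upper_i logq h l t i j k y)
                             (lower_i logq h l t i j k y) q q)).
    assert (HJ : forall y : C, y <> 0 -> In y [x / q; x; q * x] ->
              is_jackson q (kernel q Lam b d y) (d i) (J y)).
    { intros y Hy Iy; apply is_jackson_kernel; [exact Hq| | |now apply Hz].
      - intros f. rewrite (upper_i_roots q) by assumption.
        now apply (Cprod_map_perm i j k f _ (q * d i / y) (fun m => q * Lam * d i / b m)).
      - intros f. rewrite (lower_i_roots q) by assumption.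
        now apply (Cprod_map_perm i j k f _ (q * d i / y) (fun m => q * d i / d m)). }
    assert (Hg : forall y : C, g_i q logq logx h l t alpha i j k y
                           = xpow logx y (- alpha) * J y).
    { intros y; unfold g_i, J, d, lroot; cbv zeta; ring. }
    (* The prefactor at [qx] has [(d_i/x; q)_oo] in its denominator. *)
    pose proof (Hz (q * x) ltac:(simpl; auto)) as Zp.
    pose proof (fun a => no_zero_den_upper q _ _ a Zp) as U.
    rewrite (upper_i_roots q) in U by assumption.
    apply (satisfies_of_jackson_equation q logq logx h l t alpha _ x
             (J (x / q)) (J x) (J (q * x))); auto.
    apply (jackson_equation_fixed q Lam b d i); auto; try (apply HJ; simpl; auto).
    + apply U; left. fold d; field; auto.
    + intros m; apply U; fold Lam b d.
      destruct i, j, k, m; try congruence; simpl; auto.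
  - intros x Hx Hz.
    destruct (Hne x Hx) as [Hxm Hxp].
    set (J y := y / Lam * (qpochs_inf q (lower_0 logq h l t y ++ [q])
                           / qpochs_inf q (upper_0 logq h l t y)
                           * phi (upper_0 logq h l t y) (lower_0 logq h l t y) q q)).
    assert (HJ : forall y : C, y <> 0 -> In y [x / q; x; q * x] ->
              is_jackson q (kernel q Lam b d y) (y / Lam) (J y)).
    { intros y Hy Iy; apply is_jackson_kernel; [exact Hq| | |now apply Hz].
      - intros f. rewrite (upper_0_roots q) by assumption.
        unfold Cprod; simpl; fold Lam b d; ring.
      - intros f. rewrite (lower_0_roots q) by assumption.
        unfold Cprod; simpl; fold Lam b d; ring. }
    assert (Hg : forall y : C, y <> 0 -> g_0 q logq logx h l t alpha y
                           = xpow logx y (- alpha) * J y).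
    { intros y Hy; unfold g_0, J, Lam; cbv zeta.
      rewrite qpow_opp, xpow_1_minus by auto. unfold Cdiv; ring. }
    (* The prefactor at [x/q] has [(q/Lam; q)_oo] and [(x/b_j; q)_oo] in its denominator. *)
    pose proof (Hz (x / q) ltac:(simpl; auto)) as Zm.
    pose proof (fun a => no_zero_den_upper q _ _ a Zm) as U.
    rewrite (upper_0_roots q) in U by assumption. fold Lam b in U.
    apply (satisfies_of_jackson_equation q logq logx h l t alpha _ x
             (J (x / q)) (J x) (J (q * x))); auto.
    apply (jackson_equation_moving q Lam b d); auto; try (apply HJ; simpl; auto).
    + apply U; simpl; do 3 right; left. field; auto.
    + intros m; apply U. destruct m; simpl; [left|right; left|do 2 right; left];
        field; auto.
Qed.
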